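(* For $K>0$ and $L\in\mathbb{R}\setminus\{0\}$ consider the self-consistency equations $$r_1=V(Kr_1+Lr_2),\qquad r_2=V(Kr_2+Lr_1),\qquad r_1,r_2\in[0,1].$$ The existence of non-symmetric solutions (that is, solutions with $r_1,r_2>0$ and $r_1\ne r_2$) requires $L<0$, in which case the bifurcation point $K^*=K^*(L)$ is the unique solution $K$ to the equation $$\sqrt{1-\frac{2K}{K^2-L^2}}=V\left((K+L)\sqrt{1-\frac{2K}{K^2-L^2}}\right),$$ and the synchronization level at the bifurcation point is given by $$r^*(K^*,L)=\sqrt{1-\frac{2K^*}{(K^* )^2-L^2}}.$$
   Context: $V:\mathbb{R}\to\mathbb{R}$ is defined by $$V(x)=\frac{\int_0^{2\pi}\cos\theta\,e^{x\cos\theta}\,d\theta}{\int_0^{2\pi}e^{x\cos\theta}\,d\theta}.$$ The self-consistency equations are those for the stationary synchronization levels $r_1,r_2$ of the two communities in the two-community noisy Kuramoto model without disorder (all natural frequencies zero), with equal community sizes, noise strength $1$, the same interaction strength $K$ within each community, the same interaction strength $L$ between the communities in both directions, and phase difference $0$ between the average phases of the communities. A symmetric synchronized solution is a solution $(r,r)$ with $r>0$, i.e. $r=V((K+L)r)$. For fixed $L$, the bifurcation point is the value $K^*$ of $K$ at which the non-symmetric solutions split off from the symmetric synchronized solution. The synchronization level at the bifurcation point is the value $r^*$ for which $(r^*,r^* )$ is the symmetric synchronized solution at $(K^*,L)$ from which the non-symmetric solutions split off.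
   Formalization: Uniqueness of the solution K is stated among K>0 with K²≠L² and 1-2K/(K²-L²)>0, since K=1+√(1+L²) makes this radicand zero and solves the equation trivially as 0=V(0), with no synchronized solution. *)

(* Defs.v *)
From Stdlib Require Export Reals.
From Coquelicot Require Export Coquelicot.
Open Scope R_scope.

Definition V (x : R) : R :=
  RInt (fun theta => cos theta * exp (x * cos theta)) 0 (2 * PI)
  / RInt (fun theta => exp (x * cos theta)) 0 (2 * PI).

Definition self_consistent (K L r1 r2 : R) : Prop :=
  0 <= r1 <= 1 /\ 0 <= r2 <= 1 /\
  r1 = V (K * r1 + L * r2) /\ r2 = V (K * r2 + L * r1).

Definition nonsymmetric_solution (K L r1 r2 : R) : Prop :=
  self_consistent K L r1 r2 /\ 0 < r1 /\ 0 < r2 /\ r1 <> r2.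

Definition symmetric_synchronized (K L r : R) : Prop :=
  self_consistent K L r r /\ 0 < r.

(* Bifurcation in the standard sense: [L] is fixed, [K] is the bifurcation
   parameter, and every neighbourhood of [(K, (r, r))] in parameter-solution
   space contains a non-symmetric solution. *)
Definition splits_off_at (L K r : R) : Prop :=
  0 < K /\ symmetric_synchronized K L r /\
  forall eps : R, 0 < eps ->
    exists K' r1 r2 : R,
      0 < K' /\ Rabs (K' - K) < eps /\
      Rabs (r1 - r) < eps /\ Rabs (r2 - r) < eps /\
      nonsymmetric_solution K' L r1 r2.

Definition bifurcation_point (L K : R) : Prop :=
  exists r : R, splits_off_at L K r.

Definition level_sq (L K : R) : R := 1 - 2 * K / (K ^ 2 - L ^ 2).

(* The second and third conjuncts make the expressions meaningful, since [/]
   and [sqrt] are total.  The radicand must be strictly positive: at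
   [K = 1 + sqrt (1 + L ^ 2)] it vanishes, and the equation degenerates to
   [0 = V 0], which says nothing about a synchronized solution. *)
Definition bifurcation_equation (L K : R) : Prop :=
  0 < K /\ K ^ 2 - L ^ 2 <> 0 /\ 0 < level_sq L K /\
  sqrt (level_sq L K) = V ((K + L) * sqrt (level_sq L K)).

(* Main.v *)
Require Import Defs.
From Stdlib Require Import Reals Lra Psatz Ranalysis5.
From Coquelicot Require Import Coquelicot.
Open Scope R_scope.

(** Put [q x = V x / x] and [p = V'], so that [p = 1 - q - V ^ 2].  With
    [x_i] the argument of [V] in the equation for [r_i], a non-symmetric
    solution satisfies [x1 - x2 = (K - L) (V x1 - V x2)] and
    [x1 + x2 = (K + L) (V x1 + V x2)].  Letting both [x_i] tend to [x], a
    bifurcation forces [K - L = 1 / p x] and [K + L = 1 / q x], hence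
    [G x = -2 L] for [G = 1/p - 1/q]; and [1 - p - q = V ^ 2] is the formula for
    the synchronization level.  Everything therefore rests on [G] being an
    increasing bijection of the positive half-line, which follows from the
    differential equations of [p] and [q].  Conversely, eliminating [K] leaves
    one equation that is a perturbation of [G x = -2 L], and since [G] is
    strictly increasing the intermediate value theorem solves it for
    [x1 = z + h], [x2 = z - h] with [h > 0] arbitrarily small. *)

(** * Calculus tools *)

Lemma is_derive_eq (f : R -> R) (x l l' : R) :
  is_derive f x l -> l = l' -> is_derive f x l'.
Proof. now intros H <-. Qed.

Lemma continuous_eps (f : R -> R) (x eps : R) :
  continuous f x -> 0 < eps ->
  exists delta, 0 < delta /\
    forall y, Rabs (y - x) < delta -> Rabs (f y - f x) < eps.
Proof.
  intros Hf He.
  destruct (proj1 (filterlim_locally f (f x)) Hf (mkposreal eps He)) as [d Hd].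
  exists d; split; [apply cond_pos|].
  intros y Hy; exact (Hd y Hy).
Qed.

(* At a minimum of [f] over [[0, x]] with non-positive value, other than [0],
   the derivative from the left would be non-positive. *)
Lemma barrier (f df : R -> R) :
  (forall x, 0 <= x -> continuous f x) -> 0 <= f 0 ->
  (forall x, 0 < x -> is_derive f x (df x)) ->
  (forall x, 0 < x -> f x <= 0 -> 0 < df x) ->
  forall x, 0 < x -> 0 < f x.
Proof.
  intros Hc H0 Hd Hb x Hx.
  apply Rnot_le_lt; intros Hfx.
  assert (Hmin : exists m, 0 < m <= x /\ f m <= 0 /\
                   forall t, 0 <= t <= x -> f m <= f t).
  { destruct (continuity_ab_min f 0 x) as [m [Hm Hmx]]; [lra| |].
    { intros c Hcx; apply continuity_pt_filterlim, Hc; lra. }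
    (* If the minimum is at [0], then [f x <= 0 <= f 0] makes [x] a minimiser as well. *)
    destruct (Req_dec m 0) as [->|Hm0].
    - exists x; repeat split; try lra.
      intros t Ht; specialize (Hm t Ht); lra.
    - exists m; repeat split; try lra.
      + specialize (Hm x); lra.
      + exact Hm. }
  destruct Hmin as [m [Hmx [Hfm Hm]]].
  assert (Hdm := Hb m (proj1 Hmx) Hfm).
  destruct (proj1 (is_derive_Reals _ _ _) (Hd m (proj1 Hmx)) (df m) Hdm)
    as [d Hlim].
  (* Both halvings matter: [h < d] for the limit, and [m - h] stays in the interval. *)
  set (h := Rmin (d / 2) (m / 2)).
  assert (Hh : 0 < h) by (apply Rmin_pos; [assert (H := cond_pos d)|]; lra).
  assert (Hh1 : h <= d / 2) by apply Rmin_l.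
  assert (Hh2 : h <= m / 2) by apply Rmin_r.
  assert (Hdp := cond_pos d).
  specialize (Hlim (- h)).
  assert (Hlim' := Hlim ltac:(lra)
    ltac:(rewrite Rabs_Ropp, Rabs_right; lra)); clear Hlim.
  apply Rabs_def2 in Hlim'.
  specialize (Hm (m + - h) ltac:(lra)).
  assert (Hq : 0 < (f (m + - h) - f m) / - h) by lra.
  assert (Hq' : (f (m + - h) - f m) / - h * h = - (f (m + - h) - f m))
    by (field; lra).
  assert (0 < (f (m + - h) - f m) / - h * h) by (apply Rmult_lt_0_compat; lra).
  lra.
Qed.

(** * Trigonometric moments of the exponential weight *)

(** Up to the factor [2 * PI], the moments of [1] and [cos] are the modified Bessel functions of
    orders 0 and 1. *)
Definition moment (g : R -> R) (x : R) : R :=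
  RInt (fun t => g t * exp (x * cos t)) 0 (2 * PI).

Lemma continuous_moment_integrand (g : R -> R) (x t : R) :
  (forall s, continuous g s) -> continuous (fun t => g t * exp (x * cos t)) t.
Proof.
  intros Hg; apply (continuous_mult g); [apply Hg|].
  apply (ex_derive_continuous (fun t => exp (x * cos t))); auto_derive; trivial.
Qed.

Lemma ex_RInt_moment (g : R -> R) (x : R) :
  (forall s, continuous g s) ->
  ex_RInt (fun t => g t * exp (x * cos t)) 0 (2 * PI).
Proof.
  intros Hg; apply (ex_RInt_continuous (V := R_CompleteNormedModule)).
  intros z _; now apply continuous_moment_integrand.
Qed.

(** Differentiation under the integral sign; the [x]-derivative of the integrand is jointly
    continuous. *)
Lemma is_derive_moment (g : R -> R) (x : R) :
  (forall s, continuous g s) ->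
  is_derive (moment g) x (moment (fun t => g t * cos t) x).
Proof.
  intros Hg.
  assert (HD : forall u t, Derive (fun z => g t * exp (z * cos t)) u
                           = g t * cos t * exp (u * cos t)).
  { intros u t; apply is_derive_unique; auto_derive; [trivial|ring]. }
  unfold moment.
  rewrite <- (RInt_ext (fun t => Derive (fun z => g t * exp (z * cos t)) x))
    by (intros t _; apply HD).
  apply (is_derive_RInt_param (fun z t => g t * exp (z * cos t))).
  - apply filter_forall; intros u t _; auto_derive; trivial.
  - intros t _.
    apply continuity_2d_pt_ext with (1 := fun u v => eq_sym (HD u v)).
    apply continuity_2d_pt_mult.
    + apply (continuity_1d_2d_pt_comp (fun v => g v * cos v) (fun _ v => v)).
      * apply continuity_pt_filterlim.
        apply (continuous_mult g cos); [apply Hg|apply continuous_cos].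
      * apply continuity_2d_pt_id2.
    + apply (continuity_1d_2d_pt_comp exp (fun u v => u * cos v)).
      * apply continuity_pt_filterlim, continuous_exp.
      * apply continuity_2d_pt_mult; [apply continuity_2d_pt_id1|].
        apply (continuity_1d_2d_pt_comp cos (fun _ v => v)).
        -- apply continuity_pt_filterlim, continuous_cos.
        -- apply continuity_2d_pt_id2.
  - apply filter_forall; intros u; now apply ex_RInt_moment.
Qed.

Lemma moment_le (f g : R -> R) (x : R) :
  (forall s, continuous f s) -> (forall s, continuous g s) ->
  (forall s, f s <= g s) -> moment f x <= moment g x.
Proof.
  intros Hf Hg Hfg; apply RInt_le.
  - assert (H := PI_RGT_0); lra.
  - now apply ex_RInt_moment.
  - now apply ex_RInt_moment.
  - intros t _; apply Rmult_le_compat_r; [left; apply exp_pos|apply Hfg].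
Qed.

Notation one := (fun _ : R => 1).
Notation sin2 := (fun t : R => sin t ^ 2).

Lemma continuous_one (s : R) : continuous one s.
Proof. apply continuous_const. Qed.

Lemma continuous_sin2 (s : R) : continuous sin2 s.
Proof. apply (ex_derive_continuous sin2); auto_derive; trivial. Qed.

Lemma moment_one_pos (x : R) : 0 < moment one x.
Proof.
  apply RInt_gt_0.
  - assert (H := PI_RGT_0); lra.
  - intros t _; rewrite Rmult_1_l; apply exp_pos.
  - intros t _; apply continuous_moment_integrand, continuous_one.
Qed.

(** [D] is the derivative of [sin t * exp (x * cos t)], which vanishes at both ends of the
    period. *)
Lemma moment_cos_by_parts (x : R) : moment cos x = x * moment sin2 x.
Proof.
  set (D := fun t => (cos t * exp (x * cos t))
                     - (x * (sin t ^ 2 * exp (x * cos t)))).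
  assert (H : is_RInt D 0 (2 * PI)
           (minus (sin (2 * PI) * exp (x * cos (2 * PI)))
                  (sin 0 * exp (x * cos 0)))).
  { apply (is_RInt_derive (V := R_CompleteNormedModule)
             (fun t => sin t * exp (x * cos t))).
    - intros t _; unfold D; auto_derive; [trivial|ring].
    - intros t _; unfold D.
      apply (ex_derive_continuous D); unfold D; auto_derive; trivial. }
  apply (is_RInt_unique (V := R_CompleteNormedModule)) in H; revert H.
  rewrite sin_2PI, sin_0, !Rmult_0_l; unfold D.
  rewrite (RInt_minus (fun t => cos t * exp (x * cos t))
             (fun t => x * (sin t ^ 2 * exp (x * cos t)))).
  - rewrite (RInt_scal (V := R_CompleteNormedModule)
               (fun t => sin t ^ 2 * exp (x * cos t))).
    + unfold minus, plus, opp, scal, mult; simpl; unfold mult; simpl.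
      unfold moment; simpl; intros H; lra.
    + now apply ex_RInt_moment; apply continuous_sin2.
  - apply ex_RInt_moment, continuous_cos.
  - apply (ex_RInt_scal (V := R_CompleteNormedModule)
             (fun t => sin t ^ 2 * exp (x * cos t))).
    apply ex_RInt_moment, continuous_sin2.
Qed.

Lemma moment_cos2 (x : R) :
  moment (fun t => cos t * cos t) x = moment one x - moment sin2 x.
Proof.
  unfold moment.
  rewrite <- (RInt_minus (V := R_CompleteNormedModule)
    (fun t => one t * exp (x * cos t)) (fun t => sin2 t * exp (x * cos t))).
  - apply RInt_ext; intros t _; unfold minus, plus, opp; simpl.
    assert (H := sin2_cos2 t); unfold Rsqr in H.
    replace (cos t * cos t) with (1 - sin t * sin t) by lra; ring.
  - apply ex_RInt_moment, continuous_one.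
  - apply ex_RInt_moment, continuous_sin2.
Qed.

(** * The functions [q] and [p] and their differential equations *)

(** Unlike [V x / x], this quotient of moments also has the right value at [0]. *)
Definition q (x : R) : R := moment sin2 x / moment one x.
(** A closed form instead of a derivative, so that smoothness is inherited from [q]. *)
Definition p (x : R) : R := 1 - q x - (x * q x) ^ 2.

Lemma V_moment (x : R) : V x = moment cos x / moment one x.
Proof.
  unfold V, moment; f_equal.
  apply RInt_ext; intros t _; symmetry; apply Rmult_1_l.
Qed.

Lemma V_q (x : R) : V x = x * q x.
Proof. rewrite V_moment, moment_cos_by_parts; unfold q, Rdiv; ring. Qed.

Lemma q_nonneg (x : R) : 0 <= q x.
Proof.
  apply Rdiv_le_0_compat; [|apply moment_one_pos].
  apply RInt_ge_0.
  - assert (H := PI_RGT_0); lra.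
  - apply ex_RInt_moment, continuous_sin2.
  - intros t _; apply Rmult_le_pos; [apply pow2_ge_0|left; apply exp_pos].
Qed.

Lemma V_le_1 (x : R) : V x <= 1.
Proof.
  assert (H := moment_one_pos x).
  rewrite V_moment; apply Rle_div_l; [exact H|]; rewrite Rmult_1_l.
  apply moment_le; [apply continuous_cos|apply continuous_one|].
  intros s; apply COS_bound.
Qed.

(** The quotient rule yields the variance of [cos] under the weight; the moment identities turn it
    into [p]. *)
Lemma is_derive_V (x : R) : is_derive V x (p x).
Proof.
  apply is_derive_ext with (1 := fun t => eq_sym (V_moment t)).
  assert (Hz := moment_one_pos x).
  assert (H1 : is_derive (moment one) x (moment cos x)).
  { apply is_derive_eq with (1 := is_derive_moment one x continuous_one).
    apply RInt_ext; intros t _; f_equal; apply Rmult_1_l. }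
  apply is_derive_eq with
    (1 := is_derive_div _ _ _ _ _ (is_derive_moment cos x continuous_cos) H1
            ltac:(lra)).
  rewrite moment_cos2, moment_cos_by_parts; unfold p, q; field; lra.
Qed.

Lemma ex_derive_q (x : R) : ex_derive q x.
Proof.
  apply ex_derive_div.
  - eexists; apply is_derive_moment, continuous_sin2.
  - eexists; apply is_derive_moment, continuous_one.
  - assert (H := moment_one_pos x); lra.
Qed.

(** Compares [V' = p] with the product rule for [V x = x * q x]. *)
Lemma q_ode (x : R) : x * Derive q x = p x - q x.
Proof.
  assert (H : is_derive V x (q x + x * Derive q x)).
  { apply is_derive_ext with (1 := fun t => eq_sym (V_q t)).
    auto_derive; [apply ex_derive_q|]; change (fun x0 => q x0) with q; ring. }
  apply is_derive_unique in H.
  rewrite (is_derive_unique _ _ _ (is_derive_V x)) in H; lra.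
Qed.

Lemma is_derive_q (x : R) : 0 < x -> is_derive q x ((p x - q x) / x).
Proof.
  intros Hx; apply is_derive_eq with (1 := Derive_correct _ _ (ex_derive_q x)).
  rewrite <- q_ode; field; lra.
Qed.

Lemma is_derive_p (x : R) :
  0 < x -> is_derive p x ((q x - p x) / x - 2 * x * q x * p x).
Proof.
  intros Hx; unfold p at 1.
  auto_derive; [repeat split; apply ex_derive_q|].
  change (fun x0 => q x0) with q.
  rewrite (is_derive_unique _ _ _ (is_derive_q x Hx)); field; lra.
Qed.

Lemma continuous_q (x : R) : continuous q x.
Proof. apply (ex_derive_continuous q), ex_derive_q. Qed.

Lemma ex_derive_p (x : R) : ex_derive p x.
Proof. unfold p; auto_derive; repeat split; apply ex_derive_q. Qed.

Lemma continuous_p (x : R) : continuous p x.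
Proof.
  apply (ex_derive_continuous p), ex_derive_p.
Qed.

Lemma continuous_V (x : R) : continuous V x.
Proof. apply (ex_derive_continuous V); eexists; apply is_derive_V. Qed.

(** * Signs and order of [V], [q] and [p] *)

(** No integral is evaluated: at [0] the differential equation reads [p 0 = q 0], while
    [p 0 = 1 - q 0]. *)
Lemma q_0 : q 0 = 1 / 2.
Proof. assert (H := q_ode 0); unfold p in H; nra. Qed.

Lemma p_0 : p 0 = 1 / 2.
Proof. unfold p; rewrite q_0; field. Qed.

Lemma V_0 : V 0 = 0.
Proof. rewrite V_q; ring. Qed.

(** Since [q >= 0], [V x <= 0] at some [x > 0] forces [q x = 0], and then [V' = p = 1]. *)
Lemma V_pos (x : R) : 0 < x -> 0 < V x.
Proof.
  revert x; apply barrier with (df := p).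
  - intros x _; apply continuous_V.
  - rewrite V_0; lra.
  - intros x _; apply is_derive_V.
  - intros x Hx HV; rewrite V_q in HV.
    assert (Hq := q_nonneg x).
    assert (Hq0 : q x = 0) by nra.
    unfold p; rewrite Hq0; lra.
Qed.

Lemma V_pos_inv (x : R) : 0 < V x -> 0 < x.
Proof.
  rewrite V_q; intros HV; assert (Hq := q_nonneg x).
  apply Rnot_le_lt; intros Hx; nra.
Qed.

Lemma q_pos (x : R) : 0 <= x -> 0 < q x.
Proof.
  intros [Hx|<-]; [|rewrite q_0; lra].
  assert (HV := V_pos x Hx); rewrite V_q in HV; nra.
Qed.

(** Where [p <= 0 < q], the first term of [p'] is positive and the second adds a nonnegative
    amount. *)
Lemma p_pos (x : R) : 0 <= x -> 0 < p x.
Proof.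
  intros [Hx|<-]; [revert x Hx|rewrite p_0; lra].
  apply barrier with (df := fun x => (q x - p x) / x - 2 * x * q x * p x).
  - intros x _; apply continuous_p.
  - rewrite p_0; lra.
  - exact is_derive_p.
  - intros x Hx Hp; assert (Hq := q_pos x ltac:(lra)).
    assert (0 < (q x - p x) / x) by (apply Rdiv_lt_0_compat; lra).
    assert (Hxq := Rmult_lt_0_compat _ _ Hx Hq).
    nra.
Qed.

Lemma p_lt_q (x : R) : 0 < x -> p x < q x.
Proof.
  intros Hx; cut (0 < q x - p x); [lra|revert x Hx].
  apply (barrier (fun x => q x - p x)
          (fun x => 2 * (p x - q x) / x + 2 * x * q x * p x)).
  - intros x _; apply (continuous_minus q p);
      [apply continuous_q|apply continuous_p].
  - rewrite p_0, q_0; lra.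
  - intros x Hx.
    apply is_derive_eq with
      (1 := is_derive_minus q p x _ _ (is_derive_q x Hx) (is_derive_p x Hx)).
    unfold minus, plus, opp; simpl; field; lra.
  - intros x Hx Hm; assert (Hq := q_pos x ltac:(lra)).
    assert (Hp := p_pos x ltac:(lra)).
    assert (0 <= 2 * (p x - q x) / x) by (apply Rdiv_le_0_compat; lra).
    assert (Hxq := Rmult_lt_0_compat _ _ Hx Hq).
    nra.
Qed.

(** * Positivity of [Phi] *)

(* Up to a positive factor [Phi] is [G'] for the function [G] below.  As a
   function of [q] and [G], it decreases in both.  Where [Phi <= 0], [q] and [G]
   do not increase (and [q] decreases), so [Phi] increases: [barrier] applies. *)
Definition Phi (x : R) : R := / q x - 2 - (q x - p x) ^ 3 / (2 * p x * q x ^ 2).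

(** The algebraic core of [Phi_pos], with [p] and [q] as plain numbers: the conclusion is the chain
    rule for [Phi], with the differential equations supplying [dp] and [dq]. *)
Lemma Phi_derivative_pos (x p q : R) :
  0 < x -> 0 < p -> p < q -> 1 - p - q = (x * q) ^ 2 ->
  / q - 2 - (q - p) ^ 3 / (2 * p * q ^ 2) <= 0 ->
  let dq := (p - q) / x in
  let dp := (q - p) / x - 2 * x * q * p in
  0 < - dq / q ^ 2
      + ((q - p) ^ 2 * (q + 2 * p) / (2 * p ^ 2 * q ^ 2)) * dp
      - (3 * (q - p) ^ 2 / (2 * p * q ^ 2) - (q - p) ^ 3 / (p * q ^ 3)) * dq.
Proof.
  intros Hx Hp Hpq Hv HPhi dq dp.
  assert (Hq : 0 < q) by lra.
  set (m := q - p) in *; assert (Hm : 0 < m) by (unfold m; lra).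
  (* [H] equals [2 p q ^ 2] times [Phi]. *)
  set (H := 2 * (1 - p - q) * p * q - m * (p ^ 2 + q ^ 2)).
  assert (HH : H <= 0).
  { replace H with ((/ q - 2 - m ^ 3 / (2 * p * q ^ 2)) * (2 * p * q ^ 2))
      by (unfold H, m; field; lra).
    assert (Hq2 := pow_lt q 2 Hq).
    assert (0 < 2 * p * q ^ 2) by (apply Rmult_lt_0_compat; lra).
    nra. }
  (* The relation [(x * q) ^ 2 = 1 - p - q] removes [x] from [dp], except for a factor [/ x]. *)
  assert (Hdp : dp = - (H + m * p ^ 2) / q ^ 2 / x).
  { unfold H; rewrite Hv; unfold dp; fold m; field; lra. }
  (* The regrouping isolates a positive term and a nonnegative multiple of [- H]. *)
  match goal with |- 0 < ?e => replace e with
    ((m / (2 * p * q ^ 4) * (2 * p * q ^ 2 + m ^ 3 * (q + 2 * p))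
     + (- H) * (m ^ 2 * (q + 2 * p) / (2 * p ^ 2 * q ^ 4))) / x) end.
  2:{ rewrite Hdp; unfold dq, m; field; lra. }
  assert (Hp2 := pow_lt p 2 Hp).
  assert (Hq2 := pow_lt q 2 Hq).
  assert (Hq4 := pow_lt q 4 Hq).
  assert (Hm2 := pow_lt m 2 Hm).
  assert (Hm3 := pow_lt m 3 Hm).
  apply Rdiv_lt_0_compat; [|exact Hx].
  apply Rplus_lt_le_0_compat.
  - apply Rmult_lt_0_compat; [apply Rdiv_lt_0_compat; nra|].
    apply Rplus_lt_0_compat; nra.
  - apply Rmult_le_pos; [lra|].
    apply Rdiv_le_0_compat; [|nra].
    apply Rmult_le_pos; lra.
Qed.

Lemma Phi_pos (x : R) : 0 < x -> 0 < Phi x.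
Proof.
  revert x; apply barrier with (df := fun x =>
    let dq := (p x - q x) / x in
    let dp := (q x - p x) / x - 2 * x * q x * p x in
    - dq / q x ^ 2
      + ((q x - p x) ^ 2 * (q x + 2 * p x) / (2 * p x ^ 2 * q x ^ 2)) * dp
      - (3 * (q x - p x) ^ 2 / (2 * p x * q x ^ 2)
         - (q x - p x) ^ 3 / (p x * q x ^ 3)) * dq).
  - intros x Hx.
    assert (Hp := p_pos x Hx); assert (Hq := q_pos x Hx).
    apply (ex_derive_continuous Phi); unfold Phi; auto_derive.
    repeat split; try lra; try apply ex_derive_q; try apply ex_derive_p.
    assert (0 < q x ^ 2) by now apply pow_lt.
    apply Rgt_not_eq; simpl in *; nra.
  - unfold Phi; rewrite p_0, q_0; apply Req_le; field.
  - intros x Hx; cbv zeta.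
    assert (Hp := p_pos x ltac:(lra)); assert (Hq := q_pos x ltac:(lra)).
    assert (Hdp := is_derive_p x Hx); assert (Hdq := is_derive_q x Hx).
    unfold Phi; auto_derive.
    + repeat split; try lra; try (eexists; eassumption).
      assert (0 < q x ^ 2) by now apply pow_lt.
    apply Rgt_not_eq; simpl in *; nra.
    + change (fun x0 => q x0) with q; change (fun x0 => p x0) with p.
      rewrite (is_derive_unique _ _ _ Hdp), (is_derive_unique _ _ _ Hdq).
      field; lra.
  - intros x Hx HPhi; apply Phi_derivative_pos; trivial.
    + apply p_pos; lra.
    + now apply p_lt_q.
    + unfold p; ring.
Qed.

(** * Monotonicity, and [G] as a bijection of the positive half-line *)

(** [barrier] applied to the increment from [x]. Only continuity is asked at [0], because the
    derivative formulas divide by [x]. *)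
Lemma increasing_of_derive_pos (f df : R -> R) :
  (forall x, 0 <= x -> continuous f x) ->
  (forall x, 0 < x -> is_derive f x (df x)) ->
  (forall x, 0 < x -> 0 < df x) ->
  forall x y, 0 <= x -> x < y -> f x < f y.
Proof.
  intros Hc Hd Hp x y Hx Hxy.
  assert (H : 0 < f (x + (y - x)) - f x).
  { generalize (y - x) (proj2 (Rlt_0_minus _ _) Hxy); intros t Ht; revert t Ht.
    apply (barrier (fun t => f (x + t) - f x) (fun t => df (x + t))).
    - intros t Ht; apply (continuous_minus (fun t => f (x + t)) (fun _ => f x)).
      + apply (continuous_comp (fun t => x + t) f); [|apply Hc; lra].
        apply (ex_derive_continuous (fun t => x + t)); auto_derive; trivial.
      + apply continuous_const.
    - rewrite Rplus_0_r; lra.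
    - intros t Ht; specialize (Hd (x + t) ltac:(lra)).
      auto_derive; [repeat split; now exists (df (x + t))|].
      change (fun x0 => f x0) with f.
      rewrite (is_derive_unique _ _ _ Hd); ring.
    - intros t Ht _; apply Hp; lra. }
  replace (x + (y - x)) with y in H by ring; lra.
Qed.

Lemma V_increasing (x y : R) : 0 <= x -> x < y -> V x < V y.
Proof.
  apply increasing_of_derive_pos with (df := p).
  - intros t _; apply continuous_V.
  - intros t _; apply is_derive_V.
  - intros t Ht; apply p_pos; lra.
Qed.

Lemma q_decreasing (x y : R) : 0 <= x -> x < y -> q y < q x.
Proof.
  intros Hx Hxy; cut (- q x < - q y); [lra|revert x y Hx Hxy].
  apply (increasing_of_derive_pos (fun x => - q x) (fun x => - ((p x - q x) / x))).
  - intros t _; apply (continuous_opp q), continuous_q.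
  - intros t Ht; apply (is_derive_opp q); now apply is_derive_q.
  - intros t Ht; assert (H := p_lt_q t Ht).
    replace (- ((p t - q t) / t)) with ((q t - p t) / t) by (field; lra).
    apply Rdiv_lt_0_compat; lra.
Qed.

Definition G (x : R) : R := / p x - / q x.

Lemma G_0 : G 0 = 0.
Proof. unfold G; rewrite p_0, q_0; field. Qed.

Lemma continuous_inv_p (x : R) : 0 <= x -> continuous (fun t => / p t) x.
Proof.
  intros Hx; assert (Hp := p_pos x Hx).
  apply (ex_derive_continuous (fun t => / p t)); auto_derive.
  repeat split; [apply ex_derive_p|lra].
Qed.

Lemma continuous_inv_q (x : R) : 0 <= x -> continuous (fun t => / q t) x.
Proof.
  intros Hx; assert (Hq := q_pos x Hx).
  apply (ex_derive_continuous (fun t => / q t)); auto_derive.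
  repeat split; [apply ex_derive_q|lra].
Qed.

Lemma continuous_G (x : R) : 0 <= x -> continuous G x.
Proof.
  intros Hx; apply (continuous_minus (fun t => / p t) (fun t => / q t)).
  - now apply continuous_inv_p.
  - now apply continuous_inv_q.
Qed.

Lemma is_derive_G (x : R) : 0 < x -> is_derive G x (2 * Phi x / (x * p x)).
Proof.
  intros Hx.
  assert (Hp := p_pos x ltac:(lra)); assert (Hq := q_pos x ltac:(lra)).
  assert (Hdp := is_derive_p x Hx); assert (Hdq := is_derive_q x Hx).
  unfold G; auto_derive.
  - repeat split; try lra; eexists; eassumption.
  - change (fun x0 => q x0) with q; change (fun x0 => p x0) with p.
    rewrite (is_derive_unique _ _ _ Hdp), (is_derive_unique _ _ _ Hdq).
    unfold Phi.
    (* As for [Phi], [(x * q x) ^ 2 = 1 - p x - q x] eliminates [x] up to a factor [/ x]. *)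
    assert (Hv : 2 * x * q x * p x = 2 * (1 - p x - q x) * p x / q x / x).
    { replace (1 - p x - q x) with ((x * q x) ^ 2) by (unfold p; ring).
      field; lra. }
    rewrite Hv; field; lra.
Qed.

Lemma G_increasing (x y : R) : 0 <= x -> x < y -> G x < G y.
Proof.
  apply increasing_of_derive_pos with (df := fun x => 2 * Phi x / (x * p x)).
  - exact continuous_G.
  - exact is_derive_G.
  - intros t Ht; assert (H := Phi_pos t Ht).
    assert (Hp := p_pos t ltac:(lra)).
    apply Rdiv_lt_0_compat; [lra|now apply Rmult_lt_0_compat].
Qed.

(* If [G <= M] then [p] is at least of order [1 / t], so that [V] would grow at
   least like a logarithm, contradicting [V <= 1]. *)
Lemma G_unbounded (M : R) : 0 <= M -> exists x, 0 < x /\ M < G x.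
Proof.
  intros HM.
  assert (HV1 := V_pos 1 Rlt_0_1).
  (* For [t >= 1], [V t >= V 1] gives [/ q t <= t / V 1], so [G t <= M] gives [/ p t <= t / k]. *)
  set (k := / (M + / V 1)).
  assert (HiV : 0 < / V 1) by now apply Rinv_0_lt_compat.
  assert (Hk : 0 < k) by (apply Rinv_0_lt_compat; lra).
  (* Chosen so that [k * ln x = 2], which would force [V x >= V 1 + 2]. *)
  set (x := exp (2 / k)).
  assert (H2k : 0 < 2 / k) by (apply Rdiv_lt_0_compat; lra).
  assert (Hx : 1 < x) by (unfold x; assert (H := exp_ineq1 (2 / k)); lra).
  destruct (Rlt_le_dec M (G x)) as [HG|HG]; [exists x; split; lra|].
  exfalso.
  assert (Hp : forall t, 1 <= t <= x -> k / t <= p t).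
  { intros t Ht.
    assert (HGt : G t <= M).
    { destruct (proj2 Ht) as [H|H]; [|rewrite H; exact HG].
      assert (H' := G_increasing t x ltac:(lra) H); lra. }
    assert (HVt : V 1 <= V t).
    { destruct (proj1 Ht) as [H|H]; [|rewrite <- H; lra].
      assert (H' := V_increasing 1 t ltac:(lra) H); lra. }
    assert (Hpt := p_pos t ltac:(lra)); assert (Hqt := q_pos t ltac:(lra)).
    assert (Hq : / q t <= t * / V 1).
    { replace (/ q t) with (t * / V t) by (rewrite V_q; field; lra).
      apply Rmult_le_compat_l; [lra|]; now apply Rinv_le_contravar. }
    assert (Hip : / p t <= t * / k).
    { unfold G in HGt; unfold k; rewrite Rinv_inv; nra. }
    replace (k / t) with (/ (t * / k)) by (field; lra).
    rewrite <- (Rinv_inv (p t)).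
    apply Rinv_le_contravar; [now apply Rinv_0_lt_compat|exact Hip]. }
  destruct (MVT_cor2 (fun t => V t - k * ln t) (fun t => p t - k / t) 1 x Hx)
    as [c [Hc Hcx]].
  { intros c Hc; apply is_derive_Reals.
    assert (H := is_derive_V c).
    auto_derive; [repeat split; [now exists (p c)|lra]|].
    change (fun x0 => V x0) with V; rewrite (is_derive_unique _ _ _ H).
    field; lra. }
  specialize (Hp c ltac:(lra)).
  rewrite ln_1 in Hc; unfold x in Hc at 2; rewrite ln_exp in Hc.
  replace (k * (2 / k)) with 2 in Hc by (field; lra).
  assert (HVx := V_le_1 x).
  assert (0 <= (p c - k / c) * (x - 1)) by (apply Rmult_le_pos; lra).
  lra.
Qed.

Lemma G_surjective (y : R) : 0 < y -> exists x, 0 < x /\ G x = y.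
Proof.
  intros Hy; destruct (G_unbounded y ltac:(lra)) as [b [Hb HGb]].
  destruct (IVT_interv (fun x => G x - y) 0 b) as [x [Hx He]]; try lra.
  - intros a Ha; apply continuity_pt_filterlim.
    apply (continuous_minus G (fun _ => y)); [apply continuous_G; lra|].
    apply continuous_const.
  - rewrite G_0; lra.
  - exists x; split; [|lra].
    destruct (Req_dec x 0) as [Hx0|]; [|lra].
    rewrite Hx0, G_0 in He; lra.
Qed.

Lemma G_injective (x y : R) : 0 < x -> 0 < y -> G x = G y -> x = y.
Proof.
  intros Hx Hy He; destruct (Rtotal_order x y) as [H|[H|H]]; trivial.
  - assert (H' := G_increasing x y ltac:(lra) H); lra.
  - assert (H' := G_increasing y x ltac:(lra) H); lra.
Qed.

(** * Limits of the secant quotients of [V] *)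

(* The second quotient is a weighted mean of [/ q x1] and [/ q x2]. *)
Lemma secant_bounds (x0 eta : R) : 0 < x0 -> 0 < eta ->
  exists delta, 0 < delta <= x0 /\
    forall x1 x2, Rabs (x1 - x0) < delta -> Rabs (x2 - x0) < delta ->
      x1 <> x2 ->
      Rabs ((x1 - x2) / (V x1 - V x2) - / p x0) < eta /\
      Rabs ((x1 + x2) / (V x1 + V x2) - / q x0) < eta.
Proof.
  intros Hx0 Heta.
  destruct (continuous_eps _ x0 eta (continuous_inv_p x0 ltac:(lra)) Heta)
    as [d1 [Hd1 Hp]].
  destruct (continuous_eps _ x0 eta (continuous_inv_q x0 ltac:(lra)) Heta)
    as [d2 [Hd2 Hq]].
  (* The bound by [x0] keeps both points positive. *)
  set (d := Rmin x0 (Rmin d1 d2)).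
  assert (Hdx : d <= x0) by apply Rmin_l.
  assert (Hdd1 : d <= d1) by (eapply Rle_trans; [apply Rmin_r|apply Rmin_l]).
  assert (Hdd2 : d <= d2) by (eapply Rle_trans; [apply Rmin_r|apply Rmin_r]).
  exists d; split; [split; [repeat apply Rmin_pos|]; assumption|].
  intros x1 x2 H1 H2 Hne.
  assert (Hq1 := Hq x1 ltac:(lra)); assert (Hq2 := Hq x2 ltac:(lra)).
  apply Rabs_def2 in H1, H2, Hq1, Hq2.
  split.
  (* By the mean value theorem the first quotient is [/ p c] with [c] between the two points; it is
     symmetric in them, so one order suffices. *)
  - assert (Hs : forall a b, x0 - d < a -> b < x0 + d -> a < b ->
              Rabs ((a - b) / (V a - V b) - / p x0) < eta).
    { intros a b Ha Hb Hab.
      destruct (MVT_cor2 V p a b Hab) as [c [Hc Hcab]].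
      { intros c _; apply is_derive_Reals, is_derive_V. }
      assert (Hpc := p_pos c ltac:(lra)).
      replace ((a - b) / (V a - V b)) with (/ p c).
      - apply Hp, Rabs_def1; lra.
      - replace (V a - V b) with (- (p c * (b - a))) by lra.
        field; split; lra. }
    destruct (Rtotal_order x1 x2) as [H|[H|H]]; [|now elim Hne|].
    + apply Hs; lra.
    + replace ((x1 - x2) / (V x1 - V x2)) with ((x2 - x1) / (V x2 - V x1)).
      * apply Hs; lra.
      * assert (HV := V_increasing x2 x1 ltac:(lra) H); field; lra.
  - assert (HV1 := V_pos x1 ltac:(lra)); assert (HV2 := V_pos x2 ltac:(lra)).
    assert (Hx : forall x, 0 < x -> x = V x * / q x).
    { intros x H; assert (H' := q_pos x ltac:(lra)); rewrite V_q; field; lra. }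
    assert (Hx1 := Hx x1 ltac:(lra)); assert (Hx2 := Hx x2 ltac:(lra)).
    set (s := V x1 + V x2); assert (Hs : 0 < s) by (unfold s; lra).
    replace ((x1 + x2) / s - / q x0)
      with ((V x1 * (/ q x1 - / q x0) + V x2 * (/ q x2 - / q x0)) / s).
    2:{ replace (x1 + x2) with (V x1 * / q x1 + V x2 * / q x2) by lra.
        assert (H := q_pos x0 ltac:(lra)).
        assert (H1' := q_pos x1 ltac:(lra)); assert (H2' := q_pos x2 ltac:(lra)).
        unfold s; field; repeat split; lra. }
    apply Rabs_def1.
    + apply Rlt_div_l; [exact Hs|unfold s; nra].
    + apply Rlt_div_r; [exact Hs|unfold s; nra].
Qed.

(** * Non-symmetric solutions require [L < 0] *)

Lemma nonsymmetric_sym (K L r1 r2 : R) :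
  nonsymmetric_solution K L r1 r2 -> nonsymmetric_solution K L r2 r1.
Proof. unfold nonsymmetric_solution, self_consistent; intuition. Qed.

(** Monotonicity of [V] gives [x2 < x1], and as [q] decreases, [r1 / x1 < r2 / x2].
    Cross-multiplied, the terms in [K] cancel and [L * (r1 ^ 2 - r2 ^ 2) < 0] remains. *)
Lemma nonsymmetric_attractive_absurd (K L r1 r2 : R) :
  0 < L -> r2 < r1 -> ~ nonsymmetric_solution K L r1 r2.
Proof.
  intros HL Hr [[_ [_ [E1 E2]]] [Hr1 [Hr2 _]]].
  set (x1 := K * r1 + L * r2) in *; set (x2 := K * r2 + L * r1) in *.
  assert (Hx1 : 0 < x1) by (apply V_pos_inv; lra).
  assert (Hx2 : 0 < x2) by (apply V_pos_inv; lra).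
  assert (Hx : x2 < x1).
  { destruct (Rtotal_order x1 x2) as [H|[H|H]]; trivial.
    - assert (H' := V_increasing x1 x2 ltac:(lra) H); lra.
    - rewrite H in E1; lra. }
  assert (Hq := q_decreasing x2 x1 ltac:(lra) Hx).
  rewrite V_q in E1, E2.
  assert (Hc : r1 * x2 < r2 * x1).
  { rewrite E1, E2.
    replace (x1 * q x1 * x2) with (x1 * x2 * q x1) by ring.
    replace (x2 * q x2 * x1) with (x1 * x2 * q x2) by ring.
    apply Rmult_lt_compat_l; [now apply Rmult_lt_0_compat|exact Hq]. }
  assert (0 < L * ((r1 - r2) * (r1 + r2))) by (repeat apply Rmult_lt_0_compat; lra).
  unfold x1, x2 in Hc; lra.
Qed.

Lemma nonsymmetric_repulsive (K L r1 r2 : R) :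
  L <> 0 -> nonsymmetric_solution K L r1 r2 -> L < 0.
Proof.
  intros HL H; apply Rnot_le_lt; intros HL'.
  destruct (Rtotal_order r1 r2) as [Hr|[Hr|Hr]].
  - apply (nonsymmetric_attractive_absurd K L r2 r1); trivial; [lra|].
    now apply nonsymmetric_sym.
  - now apply H.
  - apply (nonsymmetric_attractive_absurd K L r1 r2); trivial; lra.
Qed.

(** * Critical points and the bifurcation equation *)

(* [x] is the common argument [(K + L) * r] of [V]. *)
Definition critical (L K r : R) : Prop :=
  exists x, 0 < x /\ r = V x /\ K + L = / q x /\ K - L = / p x.

(** Subtracting the two conditions gives [G x = - 2 * L], which determines [x]. *)
Lemma critical_unique (L K r K' r' : R) :
  critical L K r -> critical L K' r' -> K = K' /\ r = r'.
Proof.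
  intros [x [Hx [-> [HK1 HK2]]]] [x' [Hx' [-> [HK1' HK2']]]].
  assert (He : x = x') by (apply G_injective; trivial; unfold G; lra).
  subst x'; split; lra.
Qed.

Lemma critical_exists (L : R) : L < 0 -> exists K r, critical L K r.
Proof.
  intros HL; destruct (G_surjective (- (2 * L)) ltac:(lra)) as [x [Hx HG]].
  exists (/ q x - L), (V x), x; unfold G in HG; repeat split; lra.
Qed.

(** Here [K ^ 2 - L ^ 2 = / (p x * q x)] and [2 * K = / p x + / q x], so the radicand is
    [1 - p x - q x = V x ^ 2]. *)
Lemma critical_level (L K r : R) :
  critical L K r -> 0 < K /\ 0 < r /\ level_sq L K = r ^ 2 /\
                    K ^ 2 - L ^ 2 <> 0 /\ r = V ((K + L) * r).
Proof.
  intros [x [Hx [-> [HK1 HK2]]]].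
  assert (Hp := p_pos x ltac:(lra)); assert (Hq := q_pos x ltac:(lra)).
  assert (Hip := Rinv_0_lt_compat _ Hp); assert (Hiq := Rinv_0_lt_compat _ Hq).
  assert (HV := V_pos x Hx).
  assert (HKL : K ^ 2 - L ^ 2 = / q x * / p x) by (rewrite <- HK1, <- HK2; ring).
  repeat split; try lra.
  - unfold level_sq; rewrite HKL.
    replace (2 * K) with (/ q x + / p x) by lra.
    rewrite V_q; replace ((x * q x) ^ 2) with (1 - q x - p x) by (unfold p; ring).
    field; lra.
  - rewrite HKL; apply Rgt_not_eq, Rmult_lt_0_compat; lra.
  - f_equal; rewrite HK1, V_q; field; lra.
Qed.

Lemma critical_bifurcation_equation (L K r : R) :
  critical L K r -> bifurcation_equation L K /\ r = sqrt (level_sq L K).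
Proof.
  intros Hc; destruct (critical_level L K r Hc) as [HK [Hr [HS [HKL HV]]]].
  assert (Hs : sqrt (level_sq L K) = r) by (rewrite HS; apply sqrt_pow2; lra).
  unfold bifurcation_equation; rewrite Hs.
  repeat split; trivial; rewrite HS; now apply pow_lt.
Qed.

(** Positivity of the radicand gives [r > 0], so [r = x * q x] yields [(K + L) * q x = 1]. The
    definition of [level_sq], with [p x = 1 - q x - r ^ 2], then yields [(K - L) * p x = 1]. *)
Lemma bifurcation_equation_critical (L K : R) :
  bifurcation_equation L K -> critical L K (sqrt (level_sq L K)).
Proof.
  intros [HK [HKL [HS HE]]].
  assert (Hr := sqrt_lt_R0 _ HS).
  assert (Hr2 := sqrt_sqrt _ (Rlt_le _ _ HS)).
  set (r := sqrt (level_sq L K)) in *; set (x := (K + L) * r) in *.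
  assert (Hr1 : r <= 1) by (rewrite HE; apply V_le_1).
  assert (Hx : 0 < x) by (apply V_pos_inv; lra).
  assert (HK1 : 0 < K + L) by (unfold x in Hx; nra).
  assert (Hp := p_pos x ltac:(lra)); assert (Hq := q_pos x ltac:(lra)).
  assert (Hq' : (K + L) * q x = 1).
  { rewrite V_q in HE; unfold x at 1 in HE; nra. }
  assert (HKL' : (K - L) * (K + L) * (1 - r * r) = 2 * K).
  { rewrite Hr2; unfold level_sq; field; trivial. }
  assert (Hp' : p x = 1 - q x - r * r).
  { unfold p; rewrite <- V_q, <- HE; ring. }
  exists x; repeat split; trivial.
  - apply (Rmult_eq_reg_r (q x)); [|lra].
    rewrite Hq'; field; lra.
  - apply (Rmult_eq_reg_r (p x)); [|lra].
    rewrite Rinv_l by lra; rewrite Hp'.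
    apply (Rmult_eq_reg_l (K + L)); [|lra].
    replace ((K + L) * ((K - L) * (1 - q x - r * r))) with
      ((K - L) * (K + L) * (1 - r * r) - (K - L) * ((K + L) * q x)) by ring.
    rewrite HKL', Hq'; ring.
Qed.

(** * Splitting off is equivalent to criticality *)

Lemma splits_off_critical (L K r : R) :
  splits_off_at L K r -> critical L K r.
Proof.
  intros [HK [[[_ [_ [E _]]] Hr] Hsplit]].
  replace (K * r + L * r) with ((K + L) * r) in E by ring.
  set (x := (K + L) * r) in *.
  assert (Hx : 0 < x) by (apply V_pos_inv; lra).
  assert (Hp := p_pos x ltac:(lra)); assert (Hq := q_pos x ltac:(lra)).
  exists x; repeat split; trivial.
  { rewrite V_q in E; apply (Rmult_eq_reg_r (q x)); [|lra].
    rewrite Rinv_l by lra; unfold x at 1 in E; nra. }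
  destruct (Req_dec (K - L) (/ p x)) as [H|H]; [exact H|exfalso].
  (* Half the supposed gap: for a nearby non-symmetric solution [K' - L] is a secant quotient within
     [eta] of [/ p x], and [K'] is within [eta] of [K]. *)
  set (eta := Rabs (K - L - / p x) / 2).
  assert (Heta : 0 < eta) by (assert (H' := Rabs_pos_lt (K - L - / p x)); unfold eta; lra).
  destruct (secant_bounds x eta Hx Heta) as [d [Hd Hsec]].
  (* Lipschitz constant for the arguments of [V]: the summand [1] bounds the level that multiplies
     [K' - K]. *)
  set (A := 1 + K + Rabs L).
  assert (HL0 := Rabs_pos L).
  set (eps := Rmin eta (d / A)).
  assert (HdA : 0 < d / A) by (apply Rdiv_lt_0_compat; unfold A; lra).
  assert (Heps : 0 < eps) by (apply Rmin_pos; lra).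
  assert (He1 : eps <= eta) by apply Rmin_l.
  assert (He2 : eps * A <= d).
  { apply Rle_div_r; [unfold A; lra|apply Rmin_r]. }
  destruct (Hsplit eps Heps)
    as [K' [r1 [r2 [HK' [HKK [Hr1 [Hr2 [[B1 [B2 [E1 E2]]] [P1 [P2 Hne]]]]]]]]]].
  assert (Hclose : forall a b, 0 <= a <= 1 -> Rabs (a - r) < eps -> Rabs (b - r) < eps ->
            Rabs (K' * a + L * b - x) < d).
  { intros a b Ha Har Hbr.
    replace (K' * a + L * b - x) with ((K' - K) * a + K * (a - r) + L * (b - r))
      by (unfold x; ring).
    assert (T := Rabs_triang ((K' - K) * a + K * (a - r)) (L * (b - r))).
    assert (T' := Rabs_triang ((K' - K) * a) (K * (a - r))).
    rewrite (Rabs_mult L) in T; rewrite (Rabs_mult _ a), (Rabs_mult K) in T'.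
    rewrite (Rabs_right a), (Rabs_right K) in T' by lra.
    assert (Rabs (K' - K) * a <= Rabs (K' - K)).
    { assert (H' := Rabs_pos (K' - K)); nra. }
    assert (K * Rabs (a - r) < K * eps) by (apply Rmult_lt_compat_l; lra).
    assert (Rabs L * Rabs (b - r) <= Rabs L * eps) by (apply Rmult_le_compat_l; lra).
    unfold A in He2; nra. }
  assert (Hne' : K' * r1 + L * r2 <> K' * r2 + L * r1).
  { intros He; apply Hne; rewrite He in E1; now rewrite E1. }
  destruct (Hsec _ _ (Hclose r1 r2 B1 Hr1 Hr2) (Hclose r2 r1 B2 Hr2 Hr1) Hne')
    as [Hs _].
  rewrite <- E1, <- E2 in Hs.
  replace ((K' * r1 + L * r2 - (K' * r2 + L * r1)) / (r1 - r2)) with (K' - L) in Hs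
    by (field; lra).
  assert (T := Rabs_triang (K' - L - / p x) (- (K' - K))).
  rewrite Rabs_Ropp in T.
  replace (K' - L - / p x + - (K' - K)) with (K - L - / p x) in T by ring.
  unfold eta in *; lra.
Qed.

Lemma critical_splits_off (L K r : R) :
  critical L K r -> splits_off_at L K r.
Proof.
  intros Hc; destruct (critical_level L K r Hc) as [HK [Hr [_ [_ HV]]]].
  assert (Hr1 : r <= 1) by (rewrite HV; apply V_le_1).
  split; [exact HK|split].
  { replace ((K + L) * r) with (K * r + L * r) in HV by ring.
    split; [repeat split; lra|exact Hr]. }
  intros eps Heps; destruct Hc as [x [Hx [-> [HK1 HK2]]]]; clear Hr Hr1 HV.
  (* The bound by [K] ensures [K' > 0]. *)
  set (eta := Rmin eps K).
  assert (Heta : 0 < eta) by now apply Rmin_pos.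
  destruct (secant_bounds x eta Hx Heta) as [d1 [Hd1 Hsec]].
  destruct (continuous_eps V x eps (continuous_V x) Heps) as [d2 [Hd2 HcV]].
  set (d := Rmin d1 d2 / 2).
  assert (Hdd1 : Rmin d1 d2 <= d1) by apply Rmin_l.
  assert (Hdd2 : Rmin d1 d2 <= d2) by apply Rmin_r.
  assert (Hd : 0 < d) by (assert (H := Rmin_pos d1 d2); unfold d; lra).
  set (a := x - d); set (b := x + d).
  assert (Ha0 : 0 < a) by (unfold a, d; lra).
  assert (HGa := G_increasing a x ltac:(lra) ltac:(unfold a; lra)).
  assert (HGb := G_increasing x b ltac:(lra) ltac:(unfold b; lra)).
  assert (HGx : G x = - (2 * L)) by (unfold G; lra).
  (* Each of the two quotients in [F] errs by less than half the gap, so [F a < G x < F b]. *)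
  destruct (secant_bounds a ((G x - G a) / 2) Ha0 ltac:(lra)) as [da [Hda Hsa]].
  destruct (secant_bounds b ((G b - G x) / 2) ltac:(unfold b; lra) ltac:(lra))
    as [db [Hdb Hsb]].
  set (h := Rmin d (Rmin da db) / 2).
  assert (Hh : 0 < h).
  { assert (0 < Rmin d (Rmin da db)) by (repeat apply Rmin_pos; lra).
    unfold h; lra. }
  assert (Hh1 := Rmin_l d (Rmin da db)); assert (Hh2 := Rmin_r d (Rmin da db)).
  assert (Hh3 := Rmin_l da db); assert (Hh4 := Rmin_r da db).
  assert (Hhd : h < d) by (unfold h in *; lra).
  assert (Hha : h < da) by (unfold h in *; lra).
  assert (Hhb : h < db) by (unfold h in *; lra).
  (* For [x1 = z + h] and [x2 = z - h] the quotients must be [K' - L] and [K' + L];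
     [F z = G x = - 2 * L] says that one [K'] serves both. *)
  set (F := fun z => (z + h - (z - h)) / (V (z + h) - V (z - h))
                     - (z + h + (z - h)) / (V (z + h) + V (z - h))).
  assert (HFa : F a < G x).
  { destruct (Hsa (a + h) (a - h)) as [S1 S2]; try (apply Rabs_def1; lra); [lra|].
    apply Rabs_def2 in S1, S2; unfold F; unfold G in S1, S2 |- *; lra. }
  assert (HFb : G x < F b).
  { destruct (Hsb (b + h) (b - h)) as [S1 S2]; try (apply Rabs_def1; lra); [lra|].
    apply Rabs_def2 in S1, S2; unfold F; unfold G in S1, S2 |- *; lra. }
  destruct (IVT_interv (fun z => F z - G x) a b) as [z [Hz HFz]];
    try (unfold a, b in *; lra).
  { intros t Ht; apply continuity_pt_filterlim.
    assert (HVi := V_increasing (t - h) (t + h) ltac:(unfold a in *; lra) ltac:(lra)).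
    assert (HVp := V_pos (t - h) ltac:(unfold a, d in *; lra)).
    apply (ex_derive_continuous (fun z => F z - G x)); unfold F; auto_derive.
    unfold Rminus in HVi, HVp.
    repeat split; try lra; eexists; apply is_derive_V. }
  set (x1 := z + h) in *; set (x2 := z - h).
  assert (Hx1 : Rabs (x1 - x) < 2 * d) by (unfold x1, a, b in *; apply Rabs_def1; lra).
  assert (Hx2 : Rabs (x2 - x) < 2 * d) by (unfold x2, a, b in *; apply Rabs_def1; lra).
  assert (Hx12 : x2 < x1) by (unfold x1, x2; lra).
  assert (Hx2p : 0 < x2) by (apply Rabs_def2 in Hx2; unfold d in *; lra).
  destruct (Hsec x1 x2) as [S1 S2]; try (unfold d in *; lra).
  assert (HVi := V_increasing x2 x1 ltac:(lra) Hx12).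
  assert (HV2 := V_pos x2 Hx2p).
  (* [K'] solves the sum equation by definition and the difference equation by the choice of [z];
     half their sum and half their difference are the two original equations. *)
  set (K' := (x1 + x2) / (V x1 + V x2) - L).
  assert (HK'1 : (K' + L) * (V x1 + V x2) = x1 + x2) by (unfold K'; field; lra).
  assert (HK'2 : (K' - L) * (V x1 - V x2) = x1 - x2).
  { replace (K' - L) with ((x1 - x2) / (V x1 - V x2)); [field; lra|].
    unfold K'; unfold F in HFz; fold x1 x2 in HFz; lra. }
  assert (E1 : K' * V x1 + L * V x2 = x1) by lra.
  assert (E2 : K' * V x2 + L * V x1 = x2) by lra.
  assert (HKK : Rabs (K' - K) < eta).
  { replace (K' - K) with ((x1 + x2) / (V x1 + V x2) - / q x) by (unfold K'; lra).
    exact S2. }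
  assert (He1 : eta <= eps) by apply Rmin_l.
  assert (He2 : eta <= K) by apply Rmin_r.
  exists K', (V x1), (V x2); repeat split; try lra.
  - apply Rabs_def2 in HKK; lra.
  - apply HcV; unfold d in *; lra.
  - apply HcV; unfold d in *; lra.
  - apply V_le_1.
  - apply V_le_1.
  - now rewrite E1.
  - now rewrite E2.
Qed.

Theorem theorem4p1 (L : R) (hL : L <> 0) :
  (forall K r1 r2 : R, 0 < K -> nonsymmetric_solution K L r1 r2 -> L < 0) /\
  (L < 0 ->
   exists Kstar : R,
     (forall K : R, bifurcation_point L K <-> K = Kstar) /\
     (forall K : R, bifurcation_equation L K <-> K = Kstar) /\
     (forall r : R, splits_off_at L Kstar r <-> r = sqrt (level_sq L Kstar))).
Proof.
  split.
  { intros K r1 r2 _ H; now apply (nonsymmetric_repulsive K L r1 r2). }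
  intros HL; destruct (critical_exists L HL) as [Ks [rs Hc]].
  destruct (critical_bifurcation_equation L Ks rs Hc) as [Heq Hlev].
  exists Ks; split; [|split].
  - intros K; split.
    + intros [r Hr]; apply splits_off_critical in Hr.
      now apply (critical_unique L K r Ks rs).
    + intros ->; exists rs; now apply critical_splits_off.
  - intros K; split.
    + intros HK; apply bifurcation_equation_critical in HK.
      now apply (critical_unique L K _ Ks rs HK).
    + now intros ->.
  - intros r; rewrite <- Hlev; split.
    + intros Hr; apply splits_off_critical in Hr.
      now apply (critical_unique L Ks r Ks rs).
    + intros ->; now apply critical_splits_off.
Qed.
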